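(* Let $q\ge 4$ be a prime power, let $n=m(2,q)$ (that is, $n=q+2$ if $q$ is even and $n=q+1$ if $q$ is odd), and let $\mathcal{C}\leqslant\mathbb{F}_q^n$ be an $[n,3,n-2]_q$ MDS code. Then there exists a generator matrix $\mathbf{G}\in\mathbb{F}_q^{3\times n}$ of $\mathcal{C}$ with the following properties: 1) $\min\{|R| : R\in\mathcal{R}_i(\mathbf{G})\text{ for some }i\in\{1,2,3\}\}=2$; 2) for every $i\in\{1,2,3\}$, the collection $\mathcal{R}_i^2(\mathbf{G})=\{R\in\mathcal{R}_i(\mathbf{G}) : |R|=2\}$ is a partition of the set $[n]=\{1,\dots,n\}$.
   Context: An $[n,k,d]_q$ code is a $k$-dimensional linear subspace of $\mathbb{F}_q^n$ with minimum Hamming distance $d$; it is MDS if $d+k=n+1$. A generator matrix of it is a $k\times n$ matrix whose rows form a basis of the code. For $\mathbf{G}=(\mathbf{g}_1\mid\dots\mid\mathbf{g}_n)\in\mathbb{F}_q^{k\times n}$ with columns $\mathbf{g}_j$, and $i\in[k]$, a recovery set for the $i$-th object is a set $J\subseteq[n]$ such that $\mathbf{e}_i\in\langle\mathbf{g}_j : j\in J\rangle$ (the $\mathbb{F}_q$-linear span), where $\mathbf{e}_i$ is the $i$-th standard basis vector of $\mathbb{F}_q^k$. A recovery set for the $i$-th object is minimal if it does not properly contain another recovery set for the $i$-th object. $\mathcal{R}_i(\mathbf{G})$ denotes the collection of minimal recovery sets for the $i$-th object. *)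

(* Defs.v *)
From mathcomp Require Import all_boot all_order all_algebra.

Set Implicit Arguments.
Unset Strict Implicit.
Unset Printing Implicit Defensive.

Import GRing.Theory.

Definition is_minimum (P : nat -> Prop) (m : nat) : Prop :=
  P m /\ forall k, P k -> m <= k.

Section Codes.

Variables (F : finFieldType) (n : nat).
Implicit Types (x y : 'rV[F]_n) (C : {vspace 'rV[F]_n}).

Definition hamming_dist x y : nat :=
  #|[set j : 'I_n | x ord0 j != y ord0 j]|.

Definition is_min_dist C (d : nat) : Prop :=
  is_minimum (fun e => exists x y,
    [/\ x \in C, y \in C, x != y & hamming_dist x y = e]) d.

Definition is_code C (k d : nat) : Prop :=
  \dim C = k /\ is_min_dist C d.

Definition is_MDS_code C (k d : nat) : Prop :=
  is_code C k d /\ d + k = n + 1.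

Definition is_generator_matrix (k : nat) C (G : 'M[F]_(k, n)) : Prop :=
  basis_of C [seq row i G | i : 'I_k].

End Codes.

Section RecoverySets.

Variables (F : finFieldType) (k n : nat) (G : 'M[F]_(k, n)) (i : 'I_k).

(* [delta_mx i ord0 : 'cV_k] is the standard basis vector e_i. *)
Definition recovery_set (J : {set 'I_n}) : bool :=
  (delta_mx i ord0 : 'cV[F]_k) \in <<[seq col j G | j in J]>>%VS.

Definition min_recovery_sets : {set {set 'I_n}} :=
  [set R | minset recovery_set R].

Definition min_recovery_sets_of_size (s : nat) : {set {set 'I_n}} :=
  [set R in min_recovery_sets | #|R| == s].

End RecoverySets.

(* The maximum size of an arc in PG(2, q), given by its known value. *)
Definition m2 (q : nat) : nat := if odd q then q + 1 else q + 2.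

(* Main.v *)
Require Import Defs.
From mathcomp Require Import all_boot all_order all_algebra.
From mathcomp Require Import finfield zify.

(** The columns of a generator matrix of [C] form an arc of [n = m2 q] points in
    the projective plane, and changing the basis of [C] amounts to replacing
    e_1, e_2, e_3 by any three independent vectors of F^3.  A vector [p] has the
    required property when it lies on no tangent of the arc and is not on the
    arc: its secants then pair off the arc points.  There are enough such
    vectors to span F^3.  Indeed each arc point has [q + 2 - n <= 1] tangents,
    and, [n] being even, a point off the arc lies on an even number of tangents,
    so at most [n * (q + 2 - n) * (q ^ 2 - q) / 2] vectors off the arc lie on a
    tangent, and more than [q ^ 2] of the [q ^ 3] vectors remain. *)

Set Implicit Arguments.
Unset Strict Implicit.
Unset Printing Implicit Defensive.

Import GRing.Theory.

(** * Spans and independent triples *)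

Section Spans.

Lemma span_image_set (K : fieldType) (vT : vectType K) (I : finType)
    (g : I -> vT) (R : {set I}) :
  (<<[seq g j | j in R]>> = \sum_(j in R) <[g j]>)%VS.
Proof. by rewrite span_def big_map big_enum. Qed.

Lemma span_image_pair (K : fieldType) (vT : vectType K) (I : finType)
    (g : I -> vT) (j l : I) :
  j != l -> (<<[seq g x | x in [set j; l]]>> = <[g j]> + <[g l]>)%VS.
Proof.
by move=> jl; rewrite span_image_set big_setU1 ?inE // big_set1.
Qed.

Lemma set2_of_mem (T : finType) (A : {set T}) (x : T) :
  #|A| = 2%N -> x \in A -> exists2 y, x != y & A = [set x; y].
Proof.
move=> /eqP/cards2P[y [z [yz ->]]]; rewrite !inE => /orP[]/eqP->.
  by exists z.
by exists y; rewrite 1?eq_sym // setUC.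
Qed.

(** At most two vectors span a subspace of at most [#|F| ^ 2] elements, which cannot contain [A]; so
    three vectors of [A] can be chosen greedily, each outside the span of those already chosen. *)
Lemma exists_free3 (F : finFieldType) (k : nat) (A : {set 'cV[F]_k}) :
  #|F| ^ 2 < #|A| ->
  exists a b c, [/\ a \in A, b \in A, c \in A & free [:: a; b; c]].
Proof.
move=> A_big; have F_gt1 : 1 < #|F| by apply: finNzRing_gt1.
have outside (X : seq 'cV[F]_k) : size X <= 2 -> exists2 a, a \in A & a \notin <<X>>%VS.
  move=> X2; apply/exists_inP; rewrite -negb_forall_in; apply/negP => /forall_inP sub.
  have : #|A| <= #|<<X>>%VS| by apply/subset_leq_card/subsetP => a /sub.
  rewrite card_vspace leqNgt (leq_ltn_trans _ A_big) // leq_exp2l //.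
  exact: leq_trans (dim_span X) X2.
have [c Ac Xc] := outside [::] isT.
have [b Ab Xb] := outside [:: c] isT.
have [a Aa Xa] := outside [:: b; c] isT.
by exists a, b, c; split; rewrite // !free_cons Xa Xb Xc nil_free.
Qed.

End Spans.

(** * Secants of an arc and the count of good vectors *)

Section Arc.

Variables (F : finFieldType) (n : nat) (g : 'I_n -> 'cV[F]_3).
Hypothesis arc : forall j l m : 'I_n, uniq [:: j; l; m] -> free [:: g j; g l; g m].
Hypothesis n_ge3 : 2 < n.

Let q := #|F|.

Definition secant j l : {vspace 'cV[F]_3} := (<[g j]> + <[g l]>)%VS.

(** Phrased through spans, as recovery sets are, so that [min_recovery_sets_of_size2] can identify
    the two notions; [pairsP] translates to secants. *)
Definition pairs (p : 'cV[F]_3) : {set {set 'I_n}} :=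
  [set R : {set 'I_n} | (#|R| == 2) && (p \in <<[seq g j | j in R]>>%VS)].

Definition off_arc : {set 'cV[F]_3} := [set p | [forall j, p \notin <[g j]>%VS]].

Lemma arc_third (j l : 'I_n) : j != l -> exists m : 'I_n, uniq [:: j; l; m].
Proof.
move=> jl; have /set0Pn[m] : ~: [set j; l] != set0.
  by rewrite -card_gt0; have := cardsC [set j; l]; rewrite cards2 jl card_ord; lia.
rewrite !inE negb_or => /andP[mj ml]; exists m.
by rewrite /= !inE negb_or jl (eq_sym j) mj (eq_sym l) ml.
Qed.

Lemma arc_free2 j l : j != l -> free [:: g j; g l].
Proof.
move=> jl; have [m /arc] := arc_third jl.
by rewrite -[X in free X]/([:: g j; g l] ++ [:: g m]) => /catl_free.
Qed.

Lemma arc_dim1 j : \dim <[g j]> = 1%N.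
Proof.
have [l jl] : exists l, j != l.
  have /set0Pn[m] : ~: [set j] != set0.
    by rewrite -card_gt0; have := cardsC [set j]; rewrite cards1 card_ord; lia.
  by rewrite !inE => mj; exists m; rewrite eq_sym.
have := arc_free2 jl; rewrite -[X in free X]/([:: g j] ++ [:: g l]) => /catl_free.
by rewrite seq1_free dim_vline => ->.
Qed.

Lemma secant_dim j l : j != l -> \dim (secant j l) = 2%N.
Proof.
move=> /arc_free2; rewrite /free /= => /eqP.
by rewrite span_cons span_seq1.
Qed.

(** If [p] had a nonzero coefficient at [g l], then [g l] would lie in the span of [g j] and [g m],
    against independence. *)
Lemma secant_cap p j l m : uniq [:: j; l; m] ->
  p \in secant j l -> p \in secant j m -> p \in <[g j]>%VS.
Proof.
move=> jlm /memv_addP[_ /vlineP[a ->] [_ /vlineP[b ->] ->]] pm.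
have [->|b0] := eqVneq b 0%R; first by rewrite scale0r addr0 memvZ ?memv_line.
have : free [:: g l; g j; g m].
  by apply: arc; move: jlm; rewrite /= !inE !negb_or (eq_sym l j) !andbT => /andP[/andP[-> ->] ->].
rewrite free_cons span_cons span_seq1 => /andP[/negP[]].
rewrite -[g l]scale1r -(mulVf b0) -scalerA memvZ //.
by rewrite -[(_ *: _)%R](addKr (a *: g j)%R) memvD // memvN (subvP (addvSl _ _)) // memvZ ?memv_line.
Qed.

Lemma pairsP p j l : j != l -> ([set j; l] \in pairs p) = (p \in secant j l).
Proof. by move=> jl; rewrite inE cards2 jl span_image_pair. Qed.

Lemma cover_pairsP p j :
  reflect (exists2 l, j != l & p \in secant j l) (j \in cover (pairs p)).
Proof.
apply: (iffP bigcupP) => [[R pR jR]|[l jl pl]].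
  have /set2_of_mem/(_ jR)[l jl eR]: #|R| = 2%N by apply/eqP; move: pR; rewrite inE => /andP[].
  by exists l; rewrite // -pairsP // -eR.
by exists [set j; l]; rewrite ?pairsP // !inE eqxx.
Qed.

(** Distinct pairs sharing [j] would give two secants through [g j] meeting at [p], which puts [p]
    on the line of [g j]. *)
Lemma pairs_partition p : p \in off_arc -> partition (pairs p) (cover (pairs p)).
Proof.
rewrite inE => /forallP p_off; rewrite /partition eqxx andTb; apply/andP; split; last first.
  by rewrite inE cards0.
apply/trivIsetP => A B pA pB; apply: contraR => /pred0Pn[j /= /andP[jA jB]].
have size2 R : R \in pairs p -> #|R| = 2%N by rewrite inE => /andP[/eqP].
have [l jl eA] := set2_of_mem (size2 _ pA) jA.
have [m jm eB] := set2_of_mem (size2 _ pB) jB.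
rewrite {}eA {}eB !pairsP // in pA pB *; have [-> //|lm] := eqVneq l m.
have /secant_cap/(_ pA)/(_ pB) : uniq [:: j; l; m] by rewrite /= !inE negb_or jl jm lm.
by rewrite (negPf (p_off j)).
Qed.

Lemma card_cover_pairs p : p \in off_arc -> #|cover (pairs p)| = (#|pairs p| * 2)%N.
Proof.
move=> /pairs_partition; apply: card_uniform_partition => R.
by rewrite inE => /andP[/eqP].
Qed.

Lemma card_off_arc : q ^ 3 <= #|off_arc| + n * q.
Proof.
have <- : #|[set: 'cV[F]_3]| = (q ^ 3)%N by rewrite cardsT card_mx muln1.
rewrite cardsT -(cardsC off_arc) leq_add2l.
have -> : ~: off_arc = \bigcup_(j < n) [set p in <[g j]>%VS].
  apply/setP => p; rewrite !inE negb_forall; apply/existsP/bigcupP => [[j]|[j _]].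
    by rewrite negbK => pj; exists j; rewrite ?inE.
  by rewrite inE => pj; exists j; rewrite negbK.
apply: leq_trans (_ : \sum_(j < n) q <= _)%N; last by rewrite sum_nat_const card_ord.
elim/big_ind2: _ => [|k A l B Ak Bl|j _]; first by rewrite cards0.
  exact: leq_trans (leq_card_setU _ _).1 (leq_add Ak Bl).
by rewrite cardsE card_vspace arc_dim1.
Qed.

(** Three kinds of vectors are disjoint in the whole space: those counted on the left, the [q]
    multiples of [g j], and, on each of the [n.-1] secants through [g j], the [q ^ 2 - q] remaining
    vectors. *)
Lemma card_unpaired j :
  #|[set p in off_arc | j \notin cover (pairs p)]| + q + n.-1 * (q ^ 2 - q) <= q ^ 3.
Proof.
(* [S j] is empty because [secant j j] is the line of [g j]; the union may therefore run over all
   [l] and still counts [n.-1] secants. *)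
pose S l : {set 'cV[F]_3} := [set p in secant j l] :\: [set p in <[g j]>%VS].
pose L : {set 'cV[F]_3} := [set p in <[g j]>%VS].
have cardS : #|\bigcup_l S l| = (n.-1 * (q ^ 2 - q))%N.
  rewrite -sum1_card partition_disjoint_bigcup; last first.
    move=> l m lm; rewrite -setI_eq0; apply/eqP/setP => p; rewrite !inE.
    apply/negP => /and3P[/andP[pj pl] _ pm]; move: (pj).
    have [jl|jl] := eqVneq j l.
      by rewrite -jl /secant addvv in pl; rewrite pl.
    have [jm|jm] := eqVneq j m.
      by rewrite -jm /secant addvv in pm; rewrite pm.
    by rewrite (secant_cap _ pl pm) // /= !inE negb_or jl jm lm.
  rewrite (bigD1 j) //= sum1_card.
  have -> : S j = set0 by apply/setP => p; rewrite !inE /secant addvv andNb.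
  rewrite cards0 add0n (eq_bigr (fun=> q ^ 2 - q)%N) => [|l lj].
    by rewrite sum_nat_const cardC1 card_ord.
  rewrite sum1_card cardsD (setIidPr _); last first.
    by apply/subsetP => p; rewrite !inE; apply: subvP; apply: addvSl.
  by rewrite !cardsE !card_vspace arc_dim1 secant_dim // eq_sym.
have cardL : #|L| = q by rewrite cardsE card_vspace arc_dim1.
have <- : #|[set: 'cV[F]_3]| = (q ^ 3)%N by rewrite cardsT card_mx muln1.
rewrite -cardS -cardL -cardsUI.
set U := [set p in _ | _]; have -> : U :&: L = set0.
  apply/setP => p; rewrite !inE; apply/negP => /andP[/andP[/forallP/(_ j)/negP pj _] /pj //].
rewrite cards0 addn0 -cardsUI (_ : _ :&: _ = set0) ?cards0 ?addn0 ?subset_leq_card //.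
apply/setP => p; rewrite in_setI in_setU !inE; apply/negP => /andP[+ /bigcupP[l _]].
rewrite !inE => + /andP[pj pl]; rewrite (negPf pj) orbF => /andP[_ /cover_pairsP[]].
exists l => //; apply: contraNneq pj => jl.
by rewrite -jl /secant addvv in pl.
Qed.

Definition good : {set 'cV[F]_3} := [set p in off_arc | cover (pairs p) == setT].

(* An even arc leaves an even number of points unpaired at [p], so a vector off
   the arc which is not good is counted at least twice. *)
Lemma card_good : ~~ odd n ->
  2 * #|off_arc| + n * (q + n.-1 * (q ^ 2 - q)) <= 2 * #|good| + n * q ^ 3.
Proof.
move=> n_even; pose U j := [set p in off_arc | j \notin cover (pairs p)].
have unpaired : (2 * #|off_arc :\: good| <= \sum_j #|U j|)%N.
  under eq_bigr do rewrite -sum1_card.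
  (* Double counting: sum over the vectors [p] the number of points unpaired at [p]. *)
  rewrite (exchange_big_dep (mem off_arc)) /=; last by move=> j p _; rewrite inE => /andP[].
  rewrite (big_setID good) /=; apply: leq_trans (leq_addl _ _).
  rewrite mulnC -sum_nat_const; apply: leq_sum => p.
  rewrite !inE => /andP[+ p_off]; rewrite p_off /= => pT.
  rewrite sum1_card; have -> : #|[pred j | p \in U j]| = #|~: cover (pairs p)|.
    by apply: eq_card => j; rewrite !inE p_off.
  have : ~: cover (pairs p) != set0 by apply: contraNneq pT => /(congr1 (@setC _)); rewrite setCK setC0 => ->.
  have := cardsC (cover (pairs p)); rewrite card_ord card_cover_pairs ?inE //.
  by rewrite -card_gt0; move: n_even; lia.
have : (\sum_j (#|U j| + (q + n.-1 * (q ^ 2 - q))) <= \sum_(j < n) q ^ 3)%N.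
  by apply: leq_sum => j _; rewrite addnA; apply: card_unpaired.
rewrite big_split /= !sum_nat_const card_ord.
have : #|off_arc| = (#|good| + #|off_arc :\: good|)%N.
  by rewrite -(cardsID good off_arc) (setIidPr _) //; apply/subsetP => p; rewrite inE => /andP[].
move=> -> le_sum; rewrite mulnDr -addnA leq_add2l.
by apply: leq_trans le_sum; rewrite leq_add2r.
Qed.

Lemma card_good_gt : 4 <= q -> n = m2 q -> q ^ 2 < #|good|.
Proof.
move=> q_ge4 n_eq.
have n_even : ~~ odd n by rewrite n_eq /m2; case: ifP; lia.
have := card_good n_even; have := card_off_arc.
move: n_eq q_ge4; rewrite /m2; case: ifP => q_odd -> q_ge4.
  (* With [n = q + 1] the two counts give [2 * #|good| >= q ^ 3 - 2 * q ^ 2 - q], which exceeds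
     [2 * q ^ 2] from [q = 5] on but not at [q = 4]. *)
  have {q_odd}q_ge5 : 5 <= q by lia.
  rewrite addn1 /= !expnS !expn0 !muln1; move: #|off_arc| #|good| => x y.
  by have [k ->] : exists k, q = (k + 5)%N; [exists (q - 5)%N; lia | nia].
(* With [n = q + 2] we have [q + n.-1 * (q ^ 2 - q) = q ^ 3]: there are no tangents, every vector
   off the arc is good, and there are at least [q ^ 3 - q ^ 2 - 2 * q] of them. *)
rewrite addn2 /= !expnS !expn0 !muln1; move: #|off_arc| #|good| => x y.
by have [k ->] : exists k, q = (k + 4)%N; [exists (q - 4)%N; lia | nia].
Qed.

End Arc.

(** * From MDS codes to arcs, and change of basis *)

Section Codes.

Variables (F : finFieldType) (n : nat).
Implicit Type C : {vspace 'rV[F]_n}.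

Lemma code_generator k C : \dim C = k ->
  exists G0 : 'M[F]_(k, n),
    (forall v, v \in C <-> exists u : 'rV_k, v = (u *m G0)%R)
    /\ (forall u : 'rV_k, (u *m G0)%R = 0%R -> u = 0%R).
Proof.
move=> dimC; case: k / dimC.
pose G0 := (\matrix_(i < \dim C) (vbasis C)`_i)%R; exists G0.
have mulG0 (u : 'rV_(\dim C)) : (u *m G0 = \sum_i u 0 i *: (vbasis C)`_i)%R.
  by rewrite mulmx_sum_row; apply: eq_bigr => i _; rewrite rowK.
split=> [v|u]; first split=> [vC|[u ->]].
- exists (\row_i coord (vbasis C) i v)%R; rewrite mulG0 [LHS](coord_vbasis vC).
  by apply: eq_bigr => i _; rewrite mxE.
- rewrite mulG0; apply: memv_suml => i _; apply: memvZ; apply: vbasis_mem.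
  by apply: mem_nth; rewrite size_tuple.
- rewrite mulG0 => u0; apply/rowP => i; rewrite mxE.
  by have /freeP/(_ (fun i => u 0 i)%R u0) := basis_free (vbasisP C).
Qed.

Definition mx_of_cols (X : seq 'cV[F]_3) : 'M[F]_3 :=
  (\matrix_(i, s) X`_s i 0)%R.

Lemma col_mx_of_cols (X : seq 'cV[F]_3) i : col i (mx_of_cols X) = (X`_i)%R.
Proof. by apply/colP => s; rewrite !mxE. Qed.

Lemma free_mx_of_cols (X : 3.-tuple 'cV[F]_3) :
  free X = (mx_of_cols X \in unitmx).
Proof.
have mulE (k : 'I_3 -> F) :
    (mx_of_cols X *m \col_s k s = \sum_s k s *: X`_s)%R.
  apply/colP => i; rewrite !(mxE, summxE); apply: eq_bigr => s _.
  by rewrite !mxE mulrC.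
apply/freeP/idP => [X_free|X_unit k k0 i].
  rewrite -unitmx_tr -row_free_unit; apply: inj_row_free => v.
  move/(congr1 trmx); rewrite trmx_mul trmxK trmx0 => v0.
  apply/rowP => s; rewrite mxE; apply: (X_free (v 0%R)); rewrite -mulE -v0.
  by congr (_ *m _)%R; apply/colP => t; rewrite !mxE.
have : (\col_s k s = 0 :> 'cV_3)%R by rewrite -[LHS](mulKmx X_unit) mulE k0 mulmx0.
by move/colP/(_ i); rewrite !mxE.
Qed.

(** If the three columns were dependent, some nonzero [v] would be orthogonal to all of them; the
    nonzero codeword [v *m G0] would vanish at [j], [l], [m] and have weight at most [n - 3], below
    the minimum distance. *)
Lemma code_arc C (G0 : 'M[F]_(3, n)) : 2 < n ->
  is_MDS_code C 3 (n - 2) ->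
  (forall v, v \in C <-> exists u : 'rV_3, v = (u *m G0)%R) ->
  (forall u : 'rV_3, (u *m G0)%R = 0%R -> u = 0%R) ->
  forall j l m : 'I_n, uniq [:: j; l; m] -> free [:: col j G0; col l G0; col m G0].
Proof.
move=> n_gt2 [[_ [_ min_dist]] _] G0_im G0_inj j l m jlm.
rewrite (free_mx_of_cols [tuple col j G0; col l G0; col m G0]) -row_free_unit.
apply: inj_row_free => v v0; apply: G0_inj; apply/eqP/negPn/negP => vG0.
have zero x : x \in [:: j; l; m] -> (v *m G0)%R ord0 x = 0%R.
  move=> x_jlm; pose s : 'I_3 := inord (index x [:: j; l; m]).
  have <- : (v *m mx_of_cols [tuple col j G0; col l G0; col m G0])%R ord0 s = (v *m G0)%R ord0 x.
    rewrite !mxE; apply: eq_bigr => i _; rewrite mxE; congr (_ * _)%R.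
    rewrite -[X in nth _ X _]/[seq col y G0 | y <- [:: j; l; m]].
    have ltx := x_jlm; rewrite -index_mem in ltx; rewrite inordK // (nth_map x) //.
    by rewrite nth_index // mxE.
  by rewrite v0 mxE.
have : n - 2 <= hamming_dist (v *m G0)%R 0%R.
  by apply: min_dist; exists (v *m G0)%R, 0%R; split; rewrite ?mem0v //; apply/G0_im; exists v.
suff : hamming_dist (v *m G0)%R 0%R <= #|[predC mem [:: j; l; m]]|.
  have := cardC (mem [:: j; l; m]); rewrite (card_uniqP jlm) card_ord /=.
  by move: #|[predC _]| (hamming_dist _ _) n_gt2 => c h; clear; lia.
rewrite /hamming_dist cardsE; apply/subset_leq_card/subsetP => x.
rewrite inE => xN; apply/negP => /zero x0.
by move: xN; rewrite unfold_in /= x0 mxE eqxx.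
Qed.

(** The dimension being 3, it is enough that the three rows span [C]. *)
Lemma generator_of_unit C (G0 : 'M[F]_(3, n)) (P : 'M[F]_3) :
  \dim C = 3 -> P \in unitmx ->
  (forall v, v \in C <-> exists u : 'rV_3, v = (u *m G0)%R) ->
  is_generator_matrix C (P *m G0)%R.
Proof.
move=> dimC P_unit G0_im; rewrite /is_generator_matrix basisEdim.
rewrite dimC size_map size_enum_ord leqnn andbT; apply/subvP => v /G0_im[u ->].
have -> : (u *m G0 = u *m invmx P *m (P *m G0))%R by rewrite mulmxA mulmxKV.
rewrite [X in X \in _]mulmx_sum_row; apply: memv_suml => i _.
by apply: memvZ; apply: memv_span; apply/imageP; exists i.
Qed.

(** Multiplication by [P] sends the standard basis vector to [col i P] and the columns of
    [invmx P *m G0] to those of [G0]; [invmx P] reverses this. *)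
Lemma recovery_set_invmx (G0 : 'M[F]_(3, n)) (P : 'M[F]_3) (i : 'I_3) (J : {set 'I_n}) :
  P \in unitmx ->
  recovery_set (invmx P *m G0)%R i J = (col i P \in <<[seq col j G0 | j in J]>>%VS).
Proof.
move=> P_unit; rewrite /recovery_set.
have sp (A : 'M[F]_3) (X : seq 'cV[F]_3) v : v \in <<X>>%VS -> (A *m v)%R \in <<[seq (A *m x)%R | x <- X]>>%VS.
  move=> vX; have := memv_img (linfun (mulmx A : 'cV_3 -> 'cV_3)) vX.
  rewrite limg_span lfunE /=; congr (_ \in <<_>>%VS).
  by apply: eq_map => x; rewrite lfunE.
apply/idP/idP => /sp.
  move/(_ P); rewrite -colE -map_comp; congr (_ \in <<_>>%VS).
  by apply: eq_map => j /=; rewrite !colE !mulmxA mulmxV // mul1mx.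
move/(_ (invmx P)); rewrite colE mulmxA mulVmx // mul1mx -map_comp.
by congr (_ \in <<_>>%VS); apply: eq_map => j /=; rewrite !colE mulmxA.
Qed.

(** The columns indexed by at most one point span no more than the line of one arc point, and
    [col i P] avoids all these lines. *)
Lemma recovery_set_card_gt1 (G0 : 'M[F]_(3, n)) (P : 'M[F]_3) (i : 'I_3)
    (R : {set 'I_n}) :
  0 < n -> P \in unitmx -> col i P \in off_arc (fun j => col j G0) ->
  recovery_set (invmx P *m G0)%R i R -> 1 < #|R|.
Proof.
move=> n_gt0 P_unit; rewrite inE => /forallP p_off; rewrite recovery_set_invmx //.
rewrite ltnNge => pR; apply/negP => R1.
have [x Rx] : exists x, R \subset [set x].
  have [->|[x xR]] := set_0Vmem R; first by exists (Ordinal n_gt0); rewrite sub0set.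
  exists x; apply/subsetP => y yR; rewrite inE.
  by rewrite (card_le1_eqP R1 _ _ xR yR).
have /negP[] := p_off x; apply: subvP pR; rewrite span_image_set.
by apply/subv_sumP => y /(subsetP Rx); rewrite inE => /eqP->.
Qed.

(** As no recovery set has fewer than two elements, those with exactly two are automatically
    minimal. *)
Lemma min_recovery_sets_of_size2 (G0 : 'M[F]_(3, n)) (P : 'M[F]_3) (i : 'I_3) :
  (forall R, recovery_set (invmx P *m G0)%R i R -> 1 < #|R|) -> P \in unitmx ->
  min_recovery_sets_of_size (invmx P *m G0)%R i 2 = pairs (fun j => col j G0) (col i P).
Proof.
move=> gt1 P_unit; apply/setP => R; rewrite !inE andbC -recovery_set_invmx //.
apply: andb_id2l => /eqP R2; apply/minsetP/idP => [[]//|recR].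
split=> // S recS SR; apply/eqP; rewrite eqEcard SR R2; exact: gt1.
Qed.

End Codes.

(** * Choice of the generator matrix *)

Theorem theorem10 (F : finFieldType) (q n : nat)
    (card_F : #|F| = q) (q_ge4 : 4 <= q) (n_eq : n = m2 q)
    (C : {vspace 'rV[F]_n}) (C_MDS : is_MDS_code C 3 (n - 2)) :
  exists G : 'M[F]_(3, n),
    [/\ is_generator_matrix C G,
        is_minimum (fun s => exists (i : 'I_3) (R : {set 'I_n}),
          R \in min_recovery_sets G i /\ #|R| = s) 2
      & forall i : 'I_3,
          partition (min_recovery_sets_of_size G i 2) [set: 'I_n]].
Proof.
have n_gt2 : 2 < n by rewrite n_eq /m2; case: ifP; lia.
have dimC : \dim C = 3 by case: C_MDS => [[]].
have [G0 [G0_im G0_inj]] := code_generator dimC.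
have arc := code_arc n_gt2 C_MDS G0_im G0_inj.
subst q; have many_good := card_good_gt arc n_gt2 q_ge4 n_eq.
have [a [b [c [ga gb gc abc]]]] := exists_free3 many_good.
(* The basis change by [invmx P] makes the good vectors [a], [b], [c] play the roles of the three
   standard basis vectors. *)
pose P := mx_of_cols [:: a; b; c].
have P_unit : P \in unitmx by rewrite -(free_mx_of_cols [tuple a; b; c]).
have P_good i : col i P \in good (fun j => col j G0).
  by rewrite col_mx_of_cols; case: i => [[|[|[|]]] ?].
have {}P_good i : col i P \in off_arc (fun j => col j G0) /\ cover (pairs (fun j => col j G0) (col i P)) = setT.
  by have := P_good i; rewrite inE => /andP[-> /eqP].
have gt1 i R := recovery_set_card_gt1 (ltn_trans (isT : 0 < 2) n_gt2) P_unit (P_good i).1 (R := R).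
have partP i : partition (min_recovery_sets_of_size (invmx P *m G0)%R i 2) [set: 'I_n].
  rewrite min_recovery_sets_of_size2 //; last exact: gt1.
  by rewrite -(P_good i).2; apply: pairs_partition arc _ (P_good i).1.
exists (invmx P *m G0)%R; split => //.
  by apply: generator_of_unit => //; rewrite unitmx_inv.
split=> [|_ [i [R [Rmin <-]]]]; last first.
  by apply: (gt1 i); move: Rmin; rewrite inE => /minsetP[].
(* The value 2 is attained: the block of the partition containing an arbitrary point, here the
   first, is a minimal recovery set of that size. *)
have : Ordinal (ltn_trans (isT : 0 < 2) n_gt2) \in cover (min_recovery_sets_of_size (invmx P *m G0)%R ord0 2).
  by rewrite (cover_partition (partP ord0)) inE.
by case/bigcupP => R; rewrite inE => /andP[Rmin /eqP R2] _; exists ord0, R.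
Qed.
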